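(* Let $\{x,x_1\}$ be a Mannheim $D$-pair of type 1 in Minkowski 3-space $E_1^3$ ($x$ a Mannheim $D$-curve and $x_1$ a Mannheim partner $D$-curve of $x$), with $x(s)$ lying on the oriented surface $S$ and $x_1(s_1)$ lying on the oriented surface $S_1$. If $x_1$ is an asymptotic curve ($k_{n_1}=0$), then the geodesic torsions $\tau_g$ of $x$ and $\tau_{g_1}$ of $x_1$ satisfy $$\tau_g=-\cosh^2\theta\;\tau_{g_1}$$ at corresponding points, where $\theta$ is the angle between the tangent vectors $T$ and $T_1$ at the corresponding points of $x$ and $x_1$.
   Context: $E_1^3$ is $\mathbb{R}^3$ with the metric $\langle u,v\rangle=-u_1v_1+u_2v_2+u_3v_3$ and the Lorentzian vector product $u\times v=(u_2v_3-u_3v_2,\;u_1v_3-u_3v_1,\;u_2v_1-u_1v_2)$. All curves and surfaces are smooth. A surface is timelike (spacelike) if its normal vector is spacelike (timelike). Type 1 means: $S$ is a spacelike surface and $x(s)$ is a spacelike curve on it; $S_1$ is a timelike surface and $x_1(s_1)$ is a spacelike curve on it; $s$ and $s_1$ are arc-length parameters. Darboux frames. $\{T,g,n\}$ is the Darboux frame of $x$: $T$ is the unit tangent, $n$ the unit normal of $S$, $g=n\times T$; here $\langle T,T\rangle=\langle g,g\rangle=1$, $\langle n,n\rangle=-1$. $\{T_1,g_1,n_1\}$ is the Darboux frame of $x_1$ on $S_1$: $T_1$ is the unit tangent, $n_1$ the unit normal of $S_1$, $g_1=n_1\times T_1$; here $\langle T_1,T_1\rangle=1$, $\langle g_1,g_1\rangle=-1$,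 $\langle n_1,n_1\rangle=1$. The normal curvature $k_{n_1}$ of $x_1$ is the coefficient of $T_1$ in $dn_1/ds_1$, i.e. $k_{n_1}=\langle dn_1/ds_1,T_1\rangle$. Geodesic torsions. In this statement the geodesic torsions are given by $$\tau_g=\left\langle \frac{dx}{ds},\,n\times\frac{dn}{ds}\right\rangle,\qquad \tau_{g_1}=\left\langle \frac{dx_1}{ds_1},\,n_1\times\frac{dn_1}{ds_1}\right\rangle .$$ Mannheim $D$-pair. $\{x,x_1\}$ is a Mannheim $D$-pair if there is a smooth regular correspondence $s=s(s_1)$ between the points of the curves such that at corresponding points the frame vector $g$ of $x$ coincides with the frame vector $n_1$ of $x_1$, i.e. $g=n_1$ and $x(s(s_1))=x_1(s_1)+\lambda n_1(s_1)$ with $\lambda$ a nonzero constant. Angle. $\theta$ is the real number with $T=\cosh\theta\,T_1+\sinh\theta\,g_1$ and $n=\sinh\theta\,T_1+\cosh\theta\,g_1$ at corresponding points. *)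

(* Defs.v *)
From HB Require Import structures.
From mathcomp Require Import all_boot all_order all_algebra.
From mathcomp Require Import all_classical all_reals all_analysis.
Set Implicit Arguments.
Unset Strict Implicit.
Unset Printing Implicit Defensive.
Import Order.TTheory GRing.Theory Num.Theory numFieldNormedType.Exports.
Local Open Scope classical_set_scope.
Local Open Scope ring_scope.

Definition cosh (R : realType) (t : R) : R := (expR t + expR (- t)) / 2.
Definition sinh (R : realType) (t : R) : R := (expR t - expR (- t)) / 2.

Section Smoothness.
Variables (R : realType) (V W : normedModType R).
Implicit Types (U A : set V) (f : V -> W).

(* Meant for open [U]. On finite-dimensional spaces, continuity of every
   [x |-> 'D_v f x] is continuity of the differential, so this is C^k. *)
Fixpoint Ck (k : nat) U f : Prop :=
  if k is k'.+1 then
    (forall x, U x -> differentiable f x) /\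
    (forall v : V, Ck k' U (fun x => 'D_v f x))
  else forall x, U x -> {for x, continuous f}.

Definition smooth U f : Prop := forall k, Ck k U f.

(* Smoothness on an arbitrary subset: locally the restriction of a smooth
   map defined on an open subset of the ambient space. *)
Definition smooth_on A f : Prop :=
  forall p, A p -> exists (O : set V) (F : V -> W),
    [/\ open O, O p, smooth O F & forall q, A q -> O q -> F q = f q].

End Smoothness.

Section Minkowski.
Variable R : realType.

(* Coordinates 1, 2, 3 are indexed by 0, 1, 2; the metric is -++. *)
Definition i0 : 'I_3 := @Ordinal 3 0 isT.
Definition i1 : 'I_3 := @Ordinal 3 1 isT.
Definition i2 : 'I_3 := @Ordinal 3 2 isT.

Definition mdot (u v : 'rV[R]_3) : R :=
  - (u 0 i0 * v 0 i0) + u 0 i1 * v 0 i1 + u 0 i2 * v 0 i2.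

Definition mcross (u v : 'rV[R]_3) : 'rV[R]_3 :=
  \row_(j < 3)
    nth 0 [:: u 0 i1 * v 0 i2 - u 0 i2 * v 0 i1;
              u 0 i0 * v 0 i2 - u 0 i2 * v 0 i0;
              u 0 i1 * v 0 i0 - u 0 i0 * v 0 i1] j.

Definition spacelike (v : 'rV[R]_3) : Prop := 0 < mdot v v \/ v = 0.
Definition timelike (v : 'rV[R]_3) : Prop := mdot v v < 0.

(* The topology of R^3 is the Euclidean one: a regular surface is covered by
   smooth homeomorphic parametrizations with injective differential. *)
Definition regular_surface (S : set 'rV[R]_3) : Prop :=
  forall p, S p ->
  exists (O : set 'rV[R]_3) (U : set 'rV[R]_2)
         (X : 'rV[R]_2 -> 'rV[R]_3) (Y : 'rV[R]_3 -> 'rV[R]_2),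
    [/\ open O /\ O p,
        open U /\ smooth U X,
        X @` U = S `&` O,
        {within S `&` O, continuous Y} /\ (forall u, U u -> Y (X u) = u) &
        forall u v, U u -> 'D_v X u = 0 -> v = 0].

(* The tangent plane, as the set of velocities at [p] of smooth curves in S. *)
Definition tangent (S : set 'rV[R]_3) (p : 'rV[R]_3) : set 'rV[R]_3 :=
  [set w | exists (e : R) (c : R -> 'rV[R]_3),
     [/\ 0 < e, smooth [set` `]-e, e[] c,
         (forall t : R, t \in `]-e, e[ -> S (c t)),
         c 0 = p & derive1 c 0 = w]].

(* [N] is a Minkowski unit normal field orienting [S]; only its values on
   [S] matter. *)
Record oriented_surface (S : set 'rV[R]_3) (N : 'rV[R]_3 -> 'rV[R]_3) : Prop :=
  OrientedSurface {
    os_regular : regular_surface S;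
    os_smooth : smooth_on S N;
    os_normal : forall p w, S p -> tangent S p w -> mdot (N p) w = 0;
    os_unit : forall p, S p -> `|mdot (N p) (N p)| = 1 }.

Definition spacelike_surface (S : set 'rV[R]_3) (N : 'rV[R]_3 -> 'rV[R]_3) :=
  oriented_surface S N /\ forall p, S p -> timelike (N p).

Definition timelike_surface (S : set 'rV[R]_3) (N : 'rV[R]_3 -> 'rV[R]_3) :=
  oriented_surface S N /\ forall p, S p -> spacelike (N p).

Record spacelike_arclength_curve (S : set 'rV[R]_3) (I : set R)
    (x : R -> 'rV[R]_3) : Prop := SpacelikeCurve {
  sc_open : open I;
  sc_interval : is_interval I;
  sc_smooth : smooth I x;
  sc_on : forall s, I s -> S (x s);
  sc_spacelike : forall s, I s -> spacelike (derive1 x s);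
  sc_unit_speed : forall s, I s -> `|mdot (derive1 x s) (derive1 x s)| = 1 }.

Section DarbouxFrame.
Variables (N : 'rV[R]_3 -> 'rV[R]_3) (x : R -> 'rV[R]_3).

Definition frame_T (s : R) : 'rV[R]_3 := derive1 x s.
Definition frame_n (s : R) : 'rV[R]_3 := N (x s).
Definition frame_g (s : R) : 'rV[R]_3 := mcross (frame_n s) (frame_T s).

Definition geodesic_torsion (s : R) : R :=
  mdot (derive1 x s) (mcross (frame_n s) (derive1 frame_n s)).

(* Coefficient of T in dn/ds, for a spacelike curve on a timelike surface. *)
Definition normal_curvature (s : R) : R := mdot (derive1 frame_n s) (frame_T s).

End DarbouxFrame.

(* [I] and [I1] are the parameter intervals; [sigma] is the correspondence
   s = s(s1). *)
Record Mannheim_D_pair_type1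
    (S : set 'rV[R]_3) (N : 'rV[R]_3 -> 'rV[R]_3)
    (I : set R) (x : R -> 'rV[R]_3)
    (S1 : set 'rV[R]_3) (N1 : 'rV[R]_3 -> 'rV[R]_3)
    (I1 : set R) (x1 : R -> 'rV[R]_3)
    (sigma : R -> R) : Prop := MannheimDPairType1 {
  md_surface : spacelike_surface S N;
  md_curve : spacelike_arclength_curve S I x;
  md_surface1 : timelike_surface S1 N1;
  md_curve1 : spacelike_arclength_curve S1 I1 x1;
  md_bij : set_bij I1 I sigma;
  md_smooth : smooth I1 sigma;
  md_regular : forall s1, I1 s1 -> derive1 sigma s1 != 0;
  md_frame : forall s1, I1 s1 -> frame_g N x (sigma s1) = frame_n N1 x1 s1;
  md_offset : exists2 lambda : R, lambda != 0 &
    forall s1, I1 s1 -> x (sigma s1) = x1 s1 + lambda *: frame_n N1 x1 s1 }.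

Definition asymptotic (N : 'rV[R]_3 -> 'rV[R]_3) (I : set R)
    (x : R -> 'rV[R]_3) : Prop :=
  forall s, I s -> normal_curvature N x s = 0.

(* [theta] is the angle between the tangents T at [s] and T1 at [s1]. *)
Definition tangent_angle (N : 'rV[R]_3 -> 'rV[R]_3) (x : R -> 'rV[R]_3)
    (N1 : 'rV[R]_3 -> 'rV[R]_3) (x1 : R -> 'rV[R]_3) (s s1 theta : R) : Prop :=
  frame_T x s = cosh theta *: frame_T x1 s1 + sinh theta *: frame_g N1 x1 s1 /\
  frame_n N x s = sinh theta *: frame_T x1 s1 + cosh theta *: frame_g N1 x1 s1.

End Minkowski.

(* Main.v *)
Require Import Defs.
From HB Require Import structures.
From mathcomp Require Import all_boot all_order all_algebra.
From mathcomp Require Import all_classical all_reals all_analysis.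
From mathcomp Require Import ring.
Import Order.TTheory GRing.Theory Num.Theory numFieldNormedType.Exports.
Local Open Scope classical_set_scope.
Local Open Scope ring_scope.
Set Implicit Arguments.
Unset Strict Implicit.

(* Write u' for derivatives with respect to s1 and s' = ds/ds1.
   Pairing the derivative of x(s(s1)) = x1 + lambda n1 with T1 gives
   s' cosh(theta) = 1, since <n1', T1> = 0.  The triple product identity turns
   the torsions into tau_g = - <g, dn/ds> and tau_g1 = - <g1, n1'>.
   Differentiating <n, n1> = <n, g> = 0 along the correspondence gives
   s' <dn/ds, g> = - <n, n1'> = - cosh(theta) <g1, n1'>, and multiplying by
   cosh(theta) yields the formula. *)

Section MinkowskiAlgebra.
Variable R : realType.
Implicit Types (a : R) (u v w : 'rV[R]_3).

Lemma mdotC u v : mdot u v = mdot v u.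
Proof. by rewrite /mdot; ring. Qed.

Lemma mdotDr u v w : mdot u (v + w) = mdot u v + mdot u w.
Proof. by rewrite /mdot !mxE; ring. Qed.

Lemma mdotZr a u v : mdot u (a *: v) = a * mdot u v.
Proof. by rewrite /mdot !mxE; ring. Qed.

Lemma mdot_mcrossl u v : mdot u (mcross u v) = 0.
Proof. by rewrite /mdot !mxE /=; ring. Qed.

Lemma mdot_mcrossr u v : mdot v (mcross u v) = 0.
Proof. by rewrite /mdot !mxE /=; ring. Qed.

(** [mdot u (mcross v w)] is minus the determinant of the rows [u], [v], [w], so exchanging [u] and
    [w] flips its sign. With [u] the tangent and [v] the normal, this makes the vector [g] appear in
    a geodesic torsion. *)
Lemma mdot_mcrossCA u v w : mdot u (mcross v w) = - mdot (mcross v u) w.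
Proof. by rewrite /mdot !mxE /=; ring. Qed.

End MinkowskiAlgebra.

Section CurveDerivatives.
Variable R : realType.
Implicit Types (t : R) (u v : R -> 'rV[R]_3).

Lemma is_derive_entry t u du j :
  is_derive t 1 u du -> is_derive t 1 (fun s => u s 0 j) (du 0 j).
Proof.
move=> [u_t <-]; rewrite derive_mx // mxE.
by apply: derivableP; move/derivable_mxP: u_t; exact.
Qed.

Lemma is_derive_mdot t u v du dv :
  is_derive t 1 u du -> is_derive t 1 v dv ->
  is_derive t 1 (fun s => mdot (u s) (v s)) (mdot (u t) dv + mdot du (v t)).
Proof.
move=> hu hv.
have uv j : is_derive t 1 (fun s => u s 0 j * v s 0 j)
    (u t 0 j * dv 0 j + v t 0 j * du 0 j).
  exact: (is_deriveM (is_derive_entry j hu) (is_derive_entry j hv)).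
have := is_deriveD (is_deriveD (is_deriveN (uv i0)) (uv i1)) (uv i2).
by move/is_derive_eq; apply; rewrite /mdot; ring.
Qed.

(** Derivability and derivative of a row vector are read entrywise, which reduces this to the scalar
    chain rule. *)
Lemma is_derive_reparam t (sigma : R -> R) u ds du :
  is_derive t 1 sigma ds -> is_derive (sigma t) 1 u du ->
  is_derive t 1 (u \o sigma) (ds *: du).
Proof.
move=> hs hu.
have ent j := is_derive1_comp (is_derive_entry j hu) hs.
have der : derivable (u \o sigma) t 1.
  by apply/derivable_mxP => i j; rewrite (ord1 i); case: (ent j).
apply: DeriveDef => //; apply/rowP => j.
by rewrite derive_mx // !mxE mulrC; case: (ent j).
Qed.

Lemma smooth_is_derive (W : normedModType R) (A : set R) (f : R -> W) t :
  smooth A f -> A t -> is_derive t 1 f (derive1 f t).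
Proof.
move=> /(_ 1%N)[f_diff _] At.
by rewrite derive1E; apply: derivableP; exact/diff_derivable/f_diff.
Qed.

(** [N] may be arbitrary off [S], so the chain rule is applied to a local smooth extension [F]
    instead. Near [t] the curve stays in [S] and, by continuity, in the domain of [F], hence
    [F \o x] and [frame_n N x] agree there. *)
Lemma frame_n_is_derive S N I (x : R -> 'rV[R]_3) t :
  oriented_surface S N -> spacelike_arclength_curve S I x -> I t ->
  is_derive t 1 (frame_n N x) (derive1 (frame_n N x) t).
Proof.
move=> [_ N_smooth _ _] [I_open _ x_smooth x_S _ _] It.
have [x_diff _] := x_smooth 1%N.
have [U [F [U_open Ux F_smooth FN]]] := N_smooth _ (x_S _ It).
have [F_diff _] := F_smooth 1%N.
have Fx : derivable (F \o x) t 1.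
  exact/diff_derivable/differentiable_comp/F_diff/Ux/x_diff.
rewrite derive1E; apply/derivableP/near_eq_derivable/Fx.
have x_U : \forall s \near t, U (x s).
  by apply: (differentiable_continuous (x_diff _ It)); exact: open_nbhs_nbhs.
by near=> s; rewrite /= /frame_n FN //; [apply: x_S|]; near: s; [exact: open_nbhs_nbhs|].
Unshelve. all: by end_near. Qed.

End CurveDerivatives.

Unset Implicit Arguments.

Theorem corollary4p3 (R : realType)
  (S : set 'rV[R]_3) (N : 'rV[R]_3 -> 'rV[R]_3)
  (I : set R) (x : R -> 'rV[R]_3)
  (S1 : set 'rV[R]_3) (N1 : 'rV[R]_3 -> 'rV[R]_3)
  (I1 : set R) (x1 : R -> 'rV[R]_3)
  (sigma : R -> R)
  (pair : Mannheim_D_pair_type1 S N I x S1 N1 I1 x1 sigma)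
  (asym : asymptotic N1 I1 x1)
  (s1 theta : R) (hs1 : I1 s1)
  (angle : tangent_angle N x N1 x1 (sigma s1) s1 theta) :
  geodesic_torsion N x (sigma s1)
    = - cosh theta ^+ 2 * geodesic_torsion N1 x1 s1.
Proof.
case: pair => [[S_or _] x_curve [S1_or _] x1_curve [sI _ _] s_smooth _ frame].
case=> lambda _ offset; case: angle => T_eq n_eq.
have Is : I (sigma s1) by exact: sI.
have I1_near : \forall t \near s1, I1 t.
  by apply: open_nbhs_nbhs; split=> //; exact: sc_open x1_curve.
have Dn := frame_n_is_derive S_or x_curve Is.
have Dn1 := frame_n_is_derive S1_or x1_curve hs1.
have Ds := smooth_is_derive s_smooth hs1.
have Dx := smooth_is_derive (sc_smooth x_curve) Is.
have Dx1 := smooth_is_derive (sc_smooth x1_curve) hs1.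
have T1T1 : mdot (derive1 x1 s1) (derive1 x1 s1) = 1.
  have := sc_unit_speed x1_curve hs1.
  (* [spacelike] admits the zero vector; unit speed excludes it, since it would give 0 = 1. *)
  case: (sc_spacelike x1_curve hs1) => [/ltW/ger0_norm-> //|->].
  by rewrite -[0](scale0r 0) mdotZr mul0r normr0 => /esym/eqP; rewrite oner_eq0.
have T1g1 : mdot (derive1 x1 s1) (frame_g N1 x1 s1) = 0 by exact: mdot_mcrossr.
have asym1 : mdot (derive1 (frame_n N1 x1) s1) (derive1 x1 s1) = 0 by exact: asym.
have velocity : derive1 sigma s1 *: derive1 x (sigma s1)
    = derive1 x1 s1 + lambda *: derive1 (frame_n N1 x1) s1.
  have [_ <-] := is_derive_reparam Ds Dx.
  have [_ <-] := is_deriveD Dx1 (is_deriveZ lambda Dn1).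
  (* The offset equation holds throughout the open set [I1], hence near [s1], so it may be
     differentiated. *)
  by apply: near_eq_derive; near=> t; apply: offset; near: t.
have s_cosh : derive1 sigma s1 * cosh theta = 1.
  have := congr1 (mdot (derive1 x1 s1)) velocity.
  rewrite /frame_T in T_eq.
  rewrite T_eq !(mdotDr, mdotZr) T1T1 T1g1 [X in lambda * X]mdotC asym1.
  by rewrite !mulr0 !addr0 mulr1.
have n_n1' : derive1 sigma s1 *
      mdot (derive1 (frame_n N x) (sigma s1)) (frame_n N1 x1 s1)
    = - mdot (frame_n N x (sigma s1)) (derive1 (frame_n N1 x1) s1).
  have [_ D0] := is_derive_mdot (is_derive_reparam Ds Dn) Dn1.
  (* Near [s1] the pairing of [n] with [n1] vanishes identically: there [n1] equals [g], a cross
     product with factor [n]. *)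
  move: D0; rewrite (near_eq_derive (g := cst 0)).
    rewrite derive_cst [X in _ + X]mdotC mdotZr [X in _ * X]mdotC => /esym/eqP.
    by rewrite addrC addr_eq0 => /eqP.
  by near=> t; rewrite -frame; [exact: mdot_mcrossl | near: t].
have n_g1 : mdot (frame_n N x (sigma s1)) (derive1 (frame_n N1 x1) s1)
    = cosh theta * mdot (frame_g N1 x1 s1) (derive1 (frame_n N1 x1) s1).
  (* The [T1] component of [n] contributes nothing because [x1] is asymptotic. *)
  by rewrite n_eq [LHS]mdotC mdotDr !mdotZr asym1 mulr0 add0r mdotC.
rewrite /geodesic_torsion !mdot_mcrossCA.
rewrite -/(frame_g N1 x1 s1) -/(frame_g N x (sigma s1)) frame // [in LHS]mdotC.
rewrite n_g1 in n_n1'.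
(* Writing 1 as [derive1 sigma s1 * cosh theta] supplies the factor that [n_n1'] needs, so no
   division occurs; [n_n1'] then yields the second [cosh theta]. *)
rewrite -[LHS]mul1r -s_cosh.
move: n_n1'; set p := mdot _ (frame_n _ _ _); set q := mdot _ _ => n_n1'.
transitivity (- cosh theta * (derive1 sigma s1 * p)); first by ring.
by rewrite n_n1'; ring.
Unshelve. all: by end_near. Qed.
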